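(* Let $\mathcal{L}$ be a set of $m$ distinct lines and $\mathcal{P}$ a set of $n$ distinct points in $\mathbb{C}^3$. Let $c$ be a constant such that no plane contains more than $c\sqrt{m}$ of the lines. Then the number of incidences satisfies $$I(\mathcal{L},\mathcal{P})\leq (3.66+0.91c^2)\, m n^{1/3} + 6.76\, n.$$
   Context: Lines and planes are complex affine lines and planes in $\mathbb{C}^3$. An incidence is a pair $(p,\ell)$ with $p\in\mathcal{P}$, $\ell\in\mathcal{L}$ and $p\in\ell$; $I(\mathcal{L},\mathcal{P})$ denotes the total number of incidences, i.e. $I(\mathcal{L},\mathcal{P})=\sum_{p\in\mathcal{P}} r(p)$, where $r(p)$ is the number of lines of $\mathcal{L}$ passing through $p$. *)

(* Defs.v *)
From HB Require Import structures.
From mathcomp Require Import all_boot all_order all_algebra finmap.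
From mathcomp Require Import all_classical all_reals all_analysis.
From mathcomp Require Import complex.
Set Implicit Arguments.
Unset Strict Implicit.
Unset Printing Implicit Defensive.
Import Order.TTheory GRing.Theory Num.Theory.
Local Open Scope classical_set_scope.
Local Open Scope ring_scope.

(* Translates of linear subspaces over R[i], so dimensions are complex. *)
Definition is_flat (R : realType) (d : nat) (A : set 'rV[R[i]]_3) : Prop :=
  exists (a : 'rV[R[i]]_3) (V : {vspace 'rV[R[i]]_3}),
    (\dim V)%VS = d /\ A = [set a + v | v in [set` V]].

Definition is_line (R : realType) (l : set 'rV[R[i]]_3) : Prop := is_flat 1 l.
Definition is_plane (R : realType) (Pi : set 'rV[R[i]]_3) : Prop := is_flat 2 Pi.

Definition lines_through (R : realType) (L : {fset set 'rV[R[i]]_3})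
    (p : 'rV[R[i]]_3) : nat :=
  #|` [fset l in L | p \in l]|%fset.

Definition lines_in (R : realType) (L : {fset set 'rV[R[i]]_3})
    (Pi : set 'rV[R[i]]_3) : nat :=
  #|` [fset l in L | `[< (l `<=` Pi)%classic >]]|%fset.

Definition incidences (R : realType) (L : {fset set 'rV[R[i]]_3})
    (P : {fset 'rV[R[i]]_3}) : nat :=
  (\sum_(p <- P) lines_through L p)%N.

(* Main.v *)
Require Import Defs.
From HB Require Import structures.
From mathcomp Require Import all_boot all_order all_algebra finmap.
From mathcomp Require Import zify ring lra.
From mathcomp Require mpoly.

(* The bound is proved by induction on the number of points and lines, with the
   hypothesis replaced by "every plane contains at most K lines" so that it is
   inherited by subconfigurations. Put y = n^(1/3). Lines with at most 3.66 y
   points and points on at most two lines can be deleted, so all lines are rich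
   and every point lies on at least three lines.

   Counting monomials gives a polynomial g <> 0 of degree at most e = [1.83 y]
   that vanishes on P; replacing g by partial derivatives, we may assume that
   the gradient of g is nonzero at some point of P. Every line has more than
   2 e points of P, so g vanishes on all lines. Let l be a line through that
   point and G = grad g along l. At a point of P on l either G = 0, or the three
   lines through the point lie in the tangent plane and force the second
   fundamental form to vanish there, so that G' is parallel to G. Hence the
   components of G x G', polynomials of degree less than 2 e, have more than 2 e
   zeros and vanish identically, and G has a constant direction N. So all the
   lines that meet l at a smooth point of P lie in the plane through l with
   normal N. This plane contains so many rich lines that it contains at least
   6.69 y^2 points of P. Deleting these points destroys at most
   m + k + K^2 / 2 incidences, where k is their number, and it decreases y by at
   least 2.23, which pays for the loss. *)

Module PolynomialMethod.
Import mpoly.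
Set Implicit Arguments.
Unset Strict Implicit.
Unset Printing Implicit Defensive.
Import Order.TTheory GRing.Theory Num.Theory.
Local Open Scope ring_scope.

(** * Restriction of polynomials in three variables to lines *)

Section Restriction.
Variable F : fieldType.
Implicit Types (f g : {mpoly F[3]}) (p v w : 'rV[F]_3).

Definition value f p : F := meval (p 0) f.

(** The substitution [f(p + X v)], as a univariate polynomial. *)
Definition restr f p v : {poly F} :=
  mmap (@polyC F) (fun i => (p 0 i)%:P + v 0 i *: 'X) f.

Lemma restrM f g p v : restr (f * g) p v = restr f p v * restr g p v.
Proof. exact: rmorphM. Qed.

Lemma restrD f g p v : restr (f + g) p v = restr f p v + restr g p v.
Proof. exact: rmorphD. Qed.

Lemma horner_restr f p v t : (restr f p v).[t] = value f (p + t *: v).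
Proof.
rewrite /restr /value /meval /mmap horner_sum; apply: eq_bigr => m _.
rewrite hornerM hornerC; congr (_ * _).
rewrite /mmap1 horner_prod; apply: eq_bigr => i _.
by rewrite horner_exp !hornerE !mxE mulrC.
Qed.

Lemma restr0 f p v : (restr f p v).[0] = value f p.
Proof. by rewrite horner_restr scale0r addr0. Qed.

Lemma size_mmap1_line p v (m : 'X_{1..3}) :
  (size (mmap1 (fun i => (p ord0 i)%:P + v ord0 i *: 'X) m)%R <= (mdeg m).+1)%N.
Proof.
rewrite /mmap1 mdegE; elim/big_ind2: _ => [|x1 x2 y1 y2 h1 h2|i _].
- by rewrite size_poly1.
- apply: leq_trans (size_polyMleq _ _) _.
  by move: (leq_add h1 h2); rewrite addSn addnS; case: (size x1 + size y1)%N.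
apply: leq_trans (size_poly_exp_leq _ _) _.
rewrite ltnS -[X in (_ <= X)%N]mul1n leq_mul2r; apply/orP; right.
rewrite -subn1 leq_subLR addn1.
apply: leq_trans (size_polyD _ _) _; rewrite geq_max.
rewrite (leq_trans (size_polyC_leq1 _)) //=.
by rewrite (leq_trans (size_scale_leq _ _)) ?size_polyX.
Qed.

Lemma size_restr f p v : (size (restr f p v) <= msize f)%N.
Proof.
apply: leq_trans (size_sum _ _ _) _; rewrite big_seq.
elim/big_ind: _ => // [x y hx hy|m hm]; first by rewrite geq_max hx.
apply: leq_trans (msize_mdeg_lt hm).
rewrite mul_polyC; apply: leq_trans (size_scale_leq _ _) _.
exact: size_mmap1_line.
Qed.

(** The chain rule. The difference [D] of the two sides is additive and obeys a Leibniz rule, so it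
    is enough that it vanishes on constants and variables. *)
Lemma deriv_restr f p v :
  (restr f p v)^`() = \sum_i v 0 i *: restr (mderiv i f) p v.
Proof.
pose D (h : {mpoly F[3]}) :=
  (restr h p v)^`() - \sum_i v 0 i *: restr (mderiv i h) p v.
suff D0 h : D h = 0 by apply/eqP; rewrite -subr_eq0; apply/eqP/D0.
have DD g h' : D (g + h') = D g + D h'.
  rewrite /D restrD derivD; under eq_bigr do rewrite mderivD restrD scalerDr.
  by rewrite big_split /= opprD addrACA.
have DM g h' : D (g * h') = D g * restr h' p v + restr g p v * D h'.
  rewrite /D restrM derivM.
  under eq_bigr do rewrite mderivM restrD !restrM scalerDr scalerAl scalerAr.
  rewrite big_split /= -mulr_suml -mulr_sumr mulrBl mulrBr opprD.
  by rewrite addrACA.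
have DC c : D c%:MP = 0.
  rewrite /D /restr mmapC derivC big1 ?subrr // => i _.
  by rewrite mderivC raddf0 scaler0.
have DX i : D 'X_i = 0.
  rewrite /D /restr mmapX mmap1U derivD derivC derivZ derivX add0r.
  rewrite (bigD1 i) //= big1 => [|j /negPf ji]; rewrite mderivX mnm1E.
    rewrite eqxx scale1r addr0; have -> : (U_(i) - U_(i) = 0)%MM.
      by apply/mnmP => j; rewrite mnmBE mnm0E subnn.
    by rewrite mpolyX0 rmorph1 subrr.
  by rewrite eq_sym ji scale0r raddf0 scaler0.
have D1 : D 1 = 0 by rewrite -mpolyC1 DC.
elim/mpolyind: h => [|c m h' _ _ Dh]; first by rewrite -mpolyC0 DC.
rewrite DD Dh addr0 -mul_mpolyC DM DC mul0r add0r mpolyXE_id.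
suff -> : D (\prod_(i < 3) 'X_i ^+ m i) = 0 by rewrite mulr0.
elim/big_ind: _ => // [g g' Dg Dg'|i _].
  by rewrite DM Dg Dg' mul0r mulr0 addr0.
by elim: (m i) => [|k IH]; rewrite ?expr0 // exprS DM DX IH mul0r mulr0 addr0.
Qed.

End Restriction.

(** * Polynomials vanishing on a finite point set, in characteristic zero *)

Section CharZero.
Variable F : numFieldType.
Implicit Types (f g : {mpoly F[3]}) (p v w : 'rV[F]_3).

Lemma msize_mderiv i f : mderiv i f != 0 -> (msize (mderiv i f) < msize f)%N.
Proof.
move=> nz.
rewrite [X in (X < _)%N]msizeE big_seq.
have f0 : (0 < msize f)%N.
  by rewrite lt0n mmeasure_poly_eq0; apply: contraNneq nz => ->; rewrite mderiv0.
elim/big_ind: _ => // [x y hx hy|m]; first by rewrite gtn_max hx.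
rewrite mcoeff_msupp mcoeff_deriv => h.
have : (m + U_(i))%MM \in msupp f.
  by rewrite mcoeff_msupp; apply: contraNneq h => ->; rewrite mul0rn.
by move/msize_mdeg_lt; rewrite mdegD mdeg1 addn1.
Qed.

(** The coefficient of a monomial [m] with [m i > 0] reappears in the [i]-th partial derivative,
    multiplied by [m i], which is invertible in characteristic zero. *)
Lemma mderiv_eq0_const f : (forall i, mderiv i f = 0) -> f = (f@_0)%:MP.
Proof.
move=> df0; apply/mpolyP => m; rewrite mcoeffC; case: (eqVneq m 0%MM) => [->|m0].
  by rewrite mulr1.
have [i mi] : exists i, (0 < m i)%N.
  apply/existsP; apply: contraNT m0 => /existsPn h.
  by apply/eqP/mnmP => i; rewrite mnm0E; apply/eqP; rewrite eqn0Ngt.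
have := mcoeff_deriv i (m - U_(i))%MM f; rewrite df0 mcoeff0 submK.
  by move/esym/eqP; rewrite mulrn_eq0 mulr0 /= => /eqP.
apply/mnm_lepP => j; rewrite mnm1E; by case: eqP => // <-.
Qed.

(** Descent on the degree: while all partial derivatives vanish on [P], one that is a nonzero
    polynomial replaces [f]. If there is none, [f] is a nonzero constant, which cannot vanish on the
    nonempty [P]. *)
Lemma vanishing_with_gradient f (P : seq 'rV[F]_3) :
  P != [::] -> f != 0 -> {in P, forall p, value f p = 0} ->
  exists g, [/\ g != 0, (msize g <= msize f)%N, {in P, forall p, value g p = 0}
    & exists i, exists2 p, p \in P & value (mderiv i g) p != 0].
Proof.
move=> P0; move: {2}(msize f) (leqnn (msize f)) => k.
elim: k f => [|k IH] f.
  by rewrite leqn0 mmeasure_poly_eq0 => /eqP ->; rewrite eqxx.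
move=> fk f0 fP.
have [/existsP[i /hasP[p pP nz]]|] :=
  boolP [exists i, has (fun p => value (mderiv i f) p != 0) P].
  by exists f; split=> //; exists i, p.
move=> /existsPn h.
have dP i : {in P, forall p, value (mderiv i f) p = 0}.
  by move=> p pP; have /hasPn/(_ p pP) := h i; rewrite negbK => /eqP.
have [/existsP[i nz]|/existsPn h0] := boolP [exists i, mderiv i f != 0].
  have lt := msize_mderiv nz.
  have [|g [g0 gle gP gd]] := IH _ _ nz (dP i).
    by rewrite -ltnS (leq_trans lt).
  by exists g; split=> //; apply: leq_trans gle (ltnW lt).
have fC : f = (f@_0)%:MP.
  by apply: mderiv_eq0_const => i; apply/eqP; rewrite -[_ == _]negbK.
have [p /fP] : exists p, p \in P.
  by case: (P) P0 => // p s; exists p; rewrite mem_head.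
by rewrite fC /value mevalC => c0; rewrite fC c0 mpolyC0 eqxx in f0.
Qed.

(** Each point imposes one linear condition on the coefficients, and there are ['C(3 + e, 3)]
    monomials of degree at most [e]; the set [T] enumerates their exponent vectors. *)
Lemma vanishing_exists (P : seq 'rV[F]_3) e :
  (size P < 'C(3 + e, 3))%N ->
  exists f, [/\ f != 0, (msize f <= e.+1)%N & {in P, forall p, value f p = 0}].
Proof.
rewrite -card_partial_ord_partitions; set T := [set t | _] => ltPT.
pose mon (k : 'I_#|T|) : 'X_{1..3} :=
  [multinom nat_of_ord (tnth (enum_val k) i) | i < 3].
have mon_inj : injective mon.
  move=> k l /mnmP kl; apply: enum_val_inj; apply: eq_from_tnth => i.
  by apply: val_inj; have := kl i; rewrite !mnmE.
have mon_deg k : (mdeg (mon k) <= e)%N.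
  have := enum_valP k; rewrite inE big_tuple mdegE.
  by apply: leq_trans; apply: leq_sum => i _; rewrite mnmE.
pose A := \matrix_(k < #|T|, j < size P) value 'X_[mon k] P`_j.
have [u u0 uA] : exists2 u : 'rV[F]_#|T|, u != 0 & u *m A = 0.
  have : kermx A != 0.
    rewrite kermx_eq0 /row_free; apply: contraTneq ltPT => <-.
    by rewrite -leqNgt rank_leq_col.
  move=> /rowV0Pn[u uk u0]; exists u => //; exact/sub_kermxP.
exists (\sum_k u 0 k *: 'X_[mon k]); split.
- have /rV0Pn[k uk] := u0.
  apply: contraNneq uk => /(congr1 (mcoeff (mon k))).
  rewrite mcoeff0 raddf_sum /= (bigD1 k) //= big1 => [|j jk].
    by rewrite addr0 mcoeffZ mcoeffX eqxx mulr1 => ->.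
  by rewrite mcoeffZ mcoeffX (inj_eq mon_inj) (negPf jk) mulr0.
- apply: leq_trans (mmeasure_sum _ _ _ _) _; apply/bigmax_leqP => k _.
  by rewrite (leq_trans (msizeZ_le _ _)) // msizeX ltnS.
move=> p /(nthP 0)[j jP <-].
have /rowP/(_ (Ordinal jP)) := uA; rewrite !mxE => <-.
rewrite /value raddf_sum /=; apply: eq_bigr => k _.
by rewrite mevalZ !mxE.
Qed.

(** * Gradients and Hessians along lines rich in points *)

Definition grad f p : 'rV[F]_3 := \row_i value (mderiv i f) p.

Definition hess f p : 'M[F]_3 :=
  \matrix_(i, j) value (mderiv i (mderiv j f)) p.

Lemma hess_sym f p : (hess f p)^T = hess f p.
Proof. by apply/matrixP => i j; rewrite !mxE mderiv_comm. Qed.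

Lemma deriv_restr_grad f p v t :
  (restr f p v)^`().[t] = (grad f (p + t *: v) *m v^T) 0 0.
Proof.
rewrite deriv_restr horner_sum mxE; apply: eq_bigr => i _.
by rewrite hornerZ horner_restr !mxE mulrC.
Qed.

Lemma deriv_restr_hess f p v i t :
  (restr (mderiv i f) p v)^`().[t] = (v *m hess f (p + t *: v)) 0 i.
Proof.
rewrite deriv_restr horner_sum mxE; apply: eq_bigr => j _.
by rewrite hornerZ horner_restr !mxE.
Qed.

Lemma restr_eq0_grad f p v : restr f p v = 0 -> grad f p *m v^T = 0.
Proof.
move=> r0; apply/matrixP => i j; rewrite !ord1.
by rewrite [RHS]mxE -[p in LHS]addr0 -(scale0r v) -deriv_restr_grad r0 deriv0 horner0.
Qed.

(** The second derivative of [f(p + t v)] at [t = 0] is the Hessian form evaluated at [v]. *)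
Lemma restr_eq0_hess f p v : restr f p v = 0 -> v *m hess f p *m v^T = 0.
Proof.
move=> r0; apply/matrixP => i j; rewrite !ord1 mxE [RHS]mxE.
have /(congr1 (fun q => q^`().[0])) := deriv_restr f p v.
rewrite r0 !deriv0 horner0 raddf_sum horner_sum /= => e0; rewrite [RHS]e0.
apply: eq_bigr => k _; rewrite derivZ hornerZ deriv_restr_hess.
by rewrite scale0r addr0 mulrC [v^T _ _]mxE.
Qed.

Lemma rank_pair v w : v != 0 -> ~~ (w <= v)%MS -> \rank (col_mx v w) = 2%N.
Proof.
move=> v0 wv; apply/eqP; rewrite eqn_leq (rank_leq_row (col_mx v w)) /=.
have vc : (v <= col_mx v w)%MS by rewrite -addsmxE addsmxSl.
have := ltn_leqif (mxrank_leqif_sup vc).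
rewrite rank_rV v0 /= => ->; apply: contra wv; apply: submx_trans.
by rewrite -addsmxE addsmxSr.
Qed.

(** The vectors orthogonal to [g] form a plane, which the independent [v] and [w1] span.
    Orthogonality is bilinear here, without conjugation. *)
Lemma sub_pair (g v w1 w2 : 'rV[F]_3) : g != 0 -> v != 0 -> ~~ (w1 <= v)%MS ->
  g *m v^T = 0 -> g *m w1^T = 0 -> g *m w2^T = 0 ->
  exists x y, w2 = x *: v + y *: w1.
Proof.
move=> g0 v0 w1v gv gw1 gw2.
have in_ker (u : 'rV[F]_3) : g *m u^T = 0 -> (u <= kermx g^T)%MS.
  by move=> gu; apply/sub_kermxP/trmx_inj; rewrite trmx_mul trmxK trmx0.
have sub : (v + w1 <= kermx g^T)%MS by rewrite addsmx_sub !in_ker.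
have := (mxrank_leqif_sup sub).2.
rewrite mxrank_ker mxrank_tr rank_rV g0 addsmxE rank_pair // eqxx => /esym sub'.
have /sub_addsmxP[[a b] /= ->] := submx_trans (in_ker _ gw2) sub'.
by exists (a 0 0), (b 0 0); rewrite -!mul_scalar_mx -!mx11_scalar.
Qed.

Lemma parallel_of_orth (g h v w : 'rV[F]_3) :
  g != 0 -> v != 0 -> ~~ (w <= v)%MS ->
  g *m v^T = 0 -> g *m w^T = 0 -> h *m v^T = 0 -> h *m w^T = 0 ->
  exists c, h = c *: g.
Proof.
move=> g0 v0 wv gv gw hv hw.
have in_ker (u : 'rV[F]_3) : 
    u *m v^T = 0 -> u *m w^T = 0 -> (u <= kermx (col_mx v w)^T)%MS.
  by move=> uv uw; apply/sub_kermxP; rewrite tr_col_mx mul_mx_row uv uw row_mx0.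
have := (mxrank_leqif_sup (in_ker g gv gw)).2.
rewrite mxrank_ker mxrank_tr rank_pair // rank_rV g0 eqxx => /esym sub.
exact/sub_rVP/(submx_trans (in_ker h hv hw)).
Qed.
(** A quadratic form on a plane with three pairwise independent isotropic vectors is zero: with
    [w2 = x v + y w1], only the cross term [2 x y (v H w1^T)] survives, and [x], [y] are nonzero. So
    [v H] is orthogonal to [v] and [w1], hence parallel to [g]. *)
Lemma tangent_flat (g v w1 w2 : 'rV[F]_3) (H : 'M[F]_3) :
  H^T = H -> g != 0 -> v != 0 ->
  ~~ (w1 <= v)%MS -> ~~ (w2 <= v)%MS -> ~~ (w2 <= w1)%MS ->
  g *m v^T = 0 -> g *m w1^T = 0 -> g *m w2^T = 0 ->
  v *m H *m v^T = 0 -> w1 *m H *m w1^T = 0 -> w2 *m H *m w2^T = 0 ->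
  exists c, v *m H = c *: g.
Proof.
move=> Hs g0 v0 w1v w2v w21 gv gw1 gw2 Hv Hw1 Hw2.
have [x [y Dw2]] := sub_pair g0 v0 w1v gv gw1 gw2.
have x0 : x != 0.
  by apply: contraNneq w21 => x0; rewrite Dw2 x0 scale0r add0r scalemx_sub.
have y0 : y != 0.
  by apply: contraNneq w2v => y0; rewrite Dw2 y0 scale0r addr0 scalemx_sub.
apply: (parallel_of_orth g0 v0 w1v gv gw1 Hv).
have sw : w1 *m H *m v^T = v *m H *m w1^T.
  have <- : (w1 *m H *m v^T)^T = v *m H *m w1^T.
    by rewrite !trmx_mul trmxK Hs mulmxA.
  by apply/matrixP => i j; rewrite !ord1 [RHS]mxE.
have Dtr : w2^T = x *: v^T + y *: w1^T by rewrite Dw2 linearD !linearZ.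
move: Hw2; rewrite Dtr Dw2 !mulmxDl !mulmxDr -!scalemxAl -!scalemxAr.
rewrite Hv Hw1 sw !scaler0 add0r addr0 scalerA [y *: _]scalerA [y * x]mulrC -mulr2n.
move=> /eqP; rewrite -scaler_nat !scaler_eq0 pnatr_eq0 mulf_eq0.
by rewrite (negPf x0) (negPf y0) /= => /eqP.
Qed.

(** The difference [s] satisfies the same relation as [r] and vanishes at [t]. If it were nonzero,
    of multiplicity [k + 1] at [t], dividing the relation by [(X - t)^k] and evaluating at [t] would
    give [(k + 1) q(t) s1(t) = 0]. *)
Lemma wronskian_eq0 (q r : {poly F}) t :
  q.[t] != 0 -> q * r^`() = r * q^`() -> r = (r.[t] / q.[t]) *: q.
Proof.
move=> qt qr; apply/eqP; rewrite -subr_eq0.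
set s := r - _; apply/negPn/negP => s0.
have qs : q * s^`() = s * q^`().
  by rewrite derivB derivZ mulrBr mulrBl qr -scalerAl -scalerAr [q * _]mulrC.
have st : root s t by rewrite /root !hornerE divfK ?subrr.
have [k [s1 s1t Ds]] := multiplicity_XsubC s t; rewrite s0 /= in s1t.
case: k => [|k] in Ds; first by rewrite Ds mulr1 (negPf s1t) in st.
have X0 : ('X - t%:P : {poly F}) ^+ k != 0.
  by rewrite expf_neq0 // polyXsubC_eq0.
have ek : q * (s1^`() * ('X - t%:P) + s1 *+ k.+1) = s1 * ('X - t%:P) * q^`().
  apply: (mulIf X0); rewrite -[RHS]mulrA [q^`() * _]mulrC mulrA -[s1 * _ * _]mulrA.
  rewrite -exprS -Ds -qs Ds derivM deriv_exp derivXsubC mul1r /= exprS.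
  by rewrite -mulrA; congr (_ * _); rewrite mulrDl mulrA mulrnAr mulrnAl.
move/(congr1 (horner^~ t)): ek; rewrite !hornerE subrr !(mulr0, mul0r) add0r.
move/eqP; rewrite mulf_eq0 (negPf qt) hornerMn mulrn_eq0 /=.
exact/negP.
Qed.

(** Richness is expressed by parameters, so that points become roots of univariate polynomials. The
    threshold [2 e] is the bound on the size of the Wronskians in [flat_plane]. *)
Definition rich (P : seq 'rV[F]_3) (e : nat) p v :=
  v != 0 /\ exists ts : seq F,
    [/\ uniq ts, (e.*2 < size ts)%N & {in ts, forall t, p + t *: v \in P}].

Lemma rich_shift P e p v t : rich P e p v -> rich P e (p + t *: v) v.
Proof.
move=> [v0 [ts [uts lts inP]]]; split=> //.
exists [seq s - t | s <- ts]; split.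
- by rewrite map_inj_uniq // => x y /addIr.
- by rewrite size_map.
move=> _ /mapP[s sts ->]; rewrite -addrA -scalerDl [t + _]addrC subrK.
exact: inP.
Qed.

Lemma rich_restr P e f p v :
  (msize f <= e.+1)%N -> {in P, forall q, value f q = 0} -> rich P e p v ->
  restr f p v = 0.
Proof.
move=> fe fP [v0 [ts [uts lts inP]]]; apply/eqP/negPn/negP => r0.
have : (size ts < size (restr f p v))%N.
  apply: max_poly_roots => //; apply/allP => t tts.
  by rewrite /root horner_restr fP // inP.
rewrite ltnNge (leq_trans (size_restr f p v)) // (leq_trans fe) //.
by apply: leq_trans lts; rewrite ltnS -addnn leq_addr.
Qed.

(** Along the chosen line the gradient of the vanishing polynomial is [G.[t] *: N]. The roots of [G]
    are thus the parameters of singular points, and rich lines through the other points are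
    orthogonal to [N]. *)
Lemma flat_plane (P : seq 'rV[F]_3) e :
  P != [::] -> (size P < 'C(3 + e, 3))%N ->
  {in P, forall p, exists v, rich P e p v} ->
  (forall p v, p \in P -> rich P e p v -> exists w1 w2,
     [/\ rich P e p w1, rich P e p w2,
         ~~ (w1 <= v)%MS, ~~ (w2 <= v)%MS & ~~ (w2 <= w1)%MS]) ->
  exists p v (N : 'rV[F]_3) (G : {poly F}),
    [/\ p \in P, rich P e p v, N != 0, N *m v^T = 0 &
     [/\ G != 0, (size G <= e)%N &
      forall t w, ~~ root G t -> p + t *: v \in P ->
        rich P e (p + t *: v) w -> N *m w^T = 0]].
Proof.
move=> P0 /vanishing_exists[f [f0 fe fP]] ex_rich three.
have [g [g0 gf gP [i0 [p pP gp]]]] := vanishing_with_gradient P0 f0 fP.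
have {f f0 fe fP gf} ge : (msize g <= e.+1)%N by apply: leq_trans gf fe.
have [v vr] := ex_rich p pP.
pose G i := restr (mderiv i g) p v.
have sG i : (size (G i) <= e)%N.
  apply: leq_trans (size_restr _ _ _) _.
  have [->|nz] := eqVneq (mderiv i g) 0; first by rewrite mmeasure0.
  by rewrite -ltnS (leq_trans (msize_mderiv nz)).
have gradE t i : (grad g (p + t *: v)) 0 i = (G i).[t].
  by rewrite mxE horner_restr.
have G0 : (G i0).[0] != 0 by rewrite /G restr0.
have orth q w : rich P e q w -> grad g q *m w^T = 0.
  by move=> qw; apply/restr_eq0_grad/(rich_restr ge gP qw).
have wr i : G i0 * (G i)^`() = G i * (G i0)^`().
  apply/eqP; rewrite -subr_eq0; set W := _ - _; apply/negPn/negP => W0.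
  have [_ [ts [uts lts inP]]] := vr.
  have : (size ts < size W)%N.
    apply: max_poly_roots => //; apply/allP => t /inP qP.
    have qv := rich_shift t vr; have [w1 [w2 [r1 r2 w1v w2v w21]]] := three _ _ qP qv.
    rewrite /root !hornerE !deriv_restr_hess -!gradE; set q := p + _ in qP qv r1 r2 *.
    have [->|gq] := eqVneq (grad g q) 0; first by rewrite !mxE !mul0r subrr.
    have hq w : rich P e q w -> w *m hess g q *m w^T = 0.
      by move=> qw; apply/restr_eq0_hess/(rich_restr ge gP qw).
    have [c ->] := tangent_flat (hess_sym g q) gq vr.1 w1v w2v w21
      (orth _ _ qv) (orth _ _ r1) (orth _ _ r2) (hq _ qv) (hq _ r1) (hq _ r2).
    by rewrite !mxE; apply/eqP; ring.
  rewrite ltnNge => /negP; apply; apply: leq_trans (ltnW lts).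
  have sM i1 i2 : (size (G i1 * (G i2)^`())%R <= e.*2)%N.
    apply: leq_trans (size_polyMleq _ _) _; apply: leq_trans (leq_pred _) _.
    rewrite -addnn leq_add //; apply: leq_trans (sG i2).
    by have [->|nz] := eqVneq (G i2) 0; rewrite ?deriv0 // ltnW // lt_size_deriv.
  by apply: leq_trans (size_polyD _ _) _; rewrite size_polyN geq_max !sM.
pose N : 'rV[F]_3 := \row_i ((G i).[0] / (G i0).[0]).
have gradN t : grad g (p + t *: v) = (G i0).[t] *: N.
  apply/rowP => i; rewrite gradE mxE mxE.
  by rewrite {1}(wronskian_eq0 G0 (wr i)) hornerZ mulrC.
have N_orth t w : ~~ root (G i0) t -> rich P e (p + t *: v) w -> N *m w^T = 0.
  move=> nr /orth; rewrite gradN -scalemxAl => /eqP.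
  by rewrite scaler_eq0 (negPf nr : _ == 0 = false) => /eqP.
exists p, v, N, (G i0); split=> //.
(* The coordinate [i0] of [N] equals 1. *)
- by apply: contraNneq (oner_neq0 F) => /rowP/(_ i0)/eqP; rewrite !mxE divff.
- by apply: (N_orth 0); rewrite ?scale0r ?addr0.
split=> //; first by apply: contraNneq G0 => ->; rewrite horner0.
by move=> t w nr _; apply: N_orth.
Qed.

End CharZero.
End PolynomialMethod.

(** * Counting and double counting in finite sequences *)

Section CountUniq.
Context {T : eqType}.
Implicit Types (a : pred T) (s : seq T).

Lemma count_le1 a s : uniq s ->
  {in s &, forall x y, a x -> a y -> x = y} -> count a s <= 1.
Proof.
move=> us aE; rewrite -size_filter.
case E: (filter a s) => [|x [|y s']] //; have := filter_uniq a us.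
have : y \in filter a s by rewrite E !inE eqxx orbT.
have : x \in filter a s by rewrite E inE eqxx.
rewrite !mem_filter => /andP[ax xs] /andP[ay ys].
by rewrite E /= inE (aE x y) ?eqxx.
Qed.

Lemma count_ge2 a s : uniq s -> 1 < count a s ->
  exists x y, [/\ x \in s, y \in s, a x, a y & x != y].
Proof.
move=> us; rewrite -size_filter.
case E: (filter a s) => [|x [|y s']] // _; have := filter_uniq a us.
have : y \in filter a s by rewrite E !inE eqxx orbT.
have : x \in filter a s by rewrite E inE eqxx.
rewrite !mem_filter => /andP[ax xs] /andP[ay ys].
by rewrite E /= inE negb_or => /andP[/andP[xy _] _]; exists x, y.
Qed.

Lemma count_others a s x k : uniq s -> k < count a s ->
  k <= count (fun y => a y && (y != x)) s.
Proof.
move=> us; rewrite -size_filter -(count_predC (pred1 x)) count_uniq_mem ?filter_uniq //.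
rewrite count_filter => h; rewrite -ltnS; apply: (leq_trans h).
rewrite -add1n leq_add ?leq_b1 //.
by apply: sub_count => y /= /andP[yx ay]; rewrite ay.
Qed.

End CountUniq.

Section DoubleCounting.
Context {A B : eqType}.
Implicit Types (inc : A -> B -> bool) (P : seq A) (L : seq B).

Lemma double_count inc P L :
  \sum_(p <- P) count (inc p) L = \sum_(l <- L) count (inc^~ l) P.
Proof.
under eq_bigr do rewrite -sum1_count big_mkcond.
rewrite exchange_big; apply: eq_bigr => l _.
by rewrite -sum1_count [in RHS]big_mkcond.
Qed.

Lemma sum_sqr_count inc P L :
  \sum_(p <- P) count (inc p) L ^ 2 =
  \sum_(l <- L) \sum_(l' <- L) count (fun p => inc p l && inc p l') P.
Proof.
transitivity (\sum_(p <- P) \sum_(l <- L) \sum_(l' <- L) (inc p l && inc p l' : nat)).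
  apply: eq_bigr => p _; rewrite -sumn_count sumnE big_map -mulnn.
  rewrite big_distrl /=; apply: eq_bigr => l _.
   by rewrite big_distrr; apply: eq_bigr => l' _; rewrite /= mulnb.
rewrite exchange_big; apply: eq_bigr => l _.
rewrite exchange_big; apply: eq_bigr => l' _.
by rewrite -sumn_count sumnE big_map.
Qed.

(** Let [r] count the elements of [L] incident to a point. The sum of [r^2] counts ordered pairs:
    the diagonal gives the sum of [r], and each other pair contributes at most 1. A linear lower
    bound for [r^2] then yields the claim. *)
Lemma sum_count_pairs inc P L :
  uniq L ->
  {in L &, forall l l', l != l' -> count (fun p => inc p l && inc p l') P <= 1} ->
  2 * \sum_(p <- P) count (inc p) L <= 2 * size P + size L ^ 2.
Proof.
move=> uL meet.
have le_sq : \sum_(p <- P) count (inc p) L ^ 2 <=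
    \sum_(p <- P) count (inc p) L + size L ^ 2.
  rewrite sum_sqr_count double_count -mulnn -[X in _ + X * _]sum1_size big_distrl.
  rewrite -big_split /= big_seq [X in _ <= X]big_seq; apply: leq_sum => l lL.
  rewrite (big_rem l lL) /= mul1n leq_add //.
    by apply: sub_count => p /andP[].
  apply: leq_trans (size_subseq (rem_subseq l L)); rewrite -sum1_size.
  rewrite big_seq [X in _ <= X]big_seq; apply: leq_sum => l'.
  rewrite mem_rem_uniq // inE => /andP[ll' l'L].
  by rewrite meet // eq_sym.
(* 3r <= r^2 + 2 for every natural number r *)
have le3 : 3 * \sum_(p <- P) count (inc p) L <=
    \sum_(p <- P) count (inc p) L ^ 2 + 2 * size P.
  rewrite -[size P]sum1_size !big_distrr -big_split /=; apply: leq_sum => p _.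
  by case: (count _ _) => [|[|[|r]]] //; nia.
lia.
Qed.

End DoubleCounting.

From mathcomp Require Import all_classical all_reals all_analysis.
From mathcomp Require Import complex.
Import Order.TTheory GRing.Theory Num.Theory.
Local Open Scope classical_set_scope.
Local Open Scope ring_scope.

(** * Lines and planes in complex three-space *)

Section Geometry.
Context {R : realType}.
Local Notation V := 'rV[R[i]]_3.
Implicit Types (p q v : V) (l Pi : set V) (P : seq V) (L : seq (set V)).

(** No base point is fixed, so one [v] parametrizes the line from each of its points. *)
Definition direction l v :=
  forall p q, p \in l -> (q \in l) <-> exists t, q = p + t *: v.

Lemma line_param l : is_line l ->
  exists2 v, v != 0 & direction l v.
Proof.
move=> [a [U [dU ->]]].
have v0 : vpick U != 0 by rewrite vpick0 -dimv_eq0 dU.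
exists (vpick U) => //.
have DU : U = <[vpick U]>%VS.
  apply/esym/eqP; rewrite eqEdim dU dim_vline v0 andbT.
  by rewrite -memvE memv_pick.
move=> p q; rewrite !inE /= => -[u uU <-]; split.
  move=> [w wU <-]; have /vlineP[k kE] : w - u \in <[vpick U]>%VS.
    by rewrite -DU memvB.
  by exists k; rewrite -kE -addrA [u + _]addrC subrK.
move=> [t ->]; exists (u + t *: vpick U); last by rewrite addrA.
by rewrite memvD // memvZ // memv_pick.
Qed.

Lemma line_eq l l' p q : is_line l -> is_line l' -> p != q ->
  p \in l -> q \in l -> p \in l' -> q \in l' -> l = l'.
Proof.
wlog suff sub : l l' / is_line l -> is_line l' -> p != q ->
  p \in l -> q \in l -> p \in l' -> q \in l' -> l `<=` l'.
  by move=> hl hl' pq pl ql pl' ql'; apply/seteqP; split; exact: sub.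
move=> /line_param[v v0 hv] /line_param[w w0 hw] pq pl ql pl' ql'.
have [t Dt] := (hv p q pl).1 ql; have [s Ds] := (hw p q pl').1 ql'.
have t0 : t != 0 by apply: contraNneq pq => t0; rewrite Dt t0 scale0r addr0.
have Dv : v = (t^-1 * s) *: w.
  apply: (scalerI t0); rewrite scalerA mulrA divff // mul1r.
  by apply: (addrI p); rewrite -Dt.
move=> x /mem_set /(hv p x pl).1[k ->]; apply/set_mem/(hw p _ pl').2.
by exists (k * (t^-1 * s)); rewrite Dv scalerA.
Qed.

Lemma lines_meet_once l l' P : is_line l -> is_line l' -> l != l' ->
  {in P &, forall p q, (p \in l) && (p \in l') -> (q \in l) && (q \in l') -> p = q}.
Proof.
move=> hl hl' /eqP ll' p q _ _ /andP[pl pl'] /andP[ql ql'].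
by apply/eqP/negPn/negP => pq; exact/ll'/(line_eq _ _ _ _ hl hl' pq).
Qed.

Lemma line_sub_flat d l Pi p q : is_line l -> is_flat d Pi -> p != q ->
  p \in l -> q \in l -> p \in Pi -> q \in Pi -> l `<=` Pi.
Proof.
move=> /line_param[v v0 hv] [a [U [_ ->]]] pq pl ql.
have [t Dt] := (hv p q pl).1 ql.
have t0 : t != 0 by apply: contraNneq pq => t0; rewrite Dt t0 scale0r addr0.
rewrite !inE /= => -[u uU Dp] [w wU Dq].
have vU : v \in U.
  have -> : v = t^-1 *: (w - u).
    apply: (scalerI t0); rewrite scalerA divff // scale1r.
    apply: (addrI p); rewrite -Dt -Dq -Dp -addrA [u + _]addrC subrK //.
  by rewrite memvZ // memvB.
move=> x /mem_set /(hv p x pl).1[k ->] /=.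
by exists (u + k *: v); [rewrite /= memvD // memvZ|rewrite addrA Dp].
Qed.

(** Rank-nullity for the functional given by [N]: its image is one-dimensional, since the basis
    vector [delta_mx 0 i] is sent to the nonzero [N 0 i]. *)
Lemma normal_plane p (N : V) : N != 0 ->
  is_plane [set q | N *m (q - p)^T = 0].
Proof.
move=> N0; pose f : 'Hom(V, 'M[R[i]]_1) := linfun (mulmxr N^T).
have fE q : f q = q *m N^T by rewrite lfunE.
have /rV0Pn[i Ni] := N0.
have dim_img : (\dim (f @: fullv) = 1)%N.
  apply/eqP; rewrite eqn_leq (leq_trans (dimvS (subvf _))) ?dimvf ?dim_matrix //=.
  rewrite lt0n dimv_eq0; apply: contraNneq Ni => img0.
  have := memv_img f (memvf (delta_mx 0 i)); rewrite img0 memv0 fE => /eqP.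
  by rewrite -rowE => /matrixP/(_ 0 0); rewrite !mxE => ->.
exists p, (lker f); split.
  have := limg_ker_dim f fullv; rewrite dim_img capfv dimvf dim_matrix addn1.
  by case.
apply/seteqP; split => q /=.
  move=> Nq; exists (q - p); last by rewrite addrC subrK.
  by rewrite /= memv_ker fE; apply/eqP/trmx_inj; rewrite trmx_mul trmxK Nq trmx0.
move=> [u uk <-]; rewrite addrAC subrr add0r; 
move: uk; rewrite /= memv_ker fE => /eqP.
by move/(congr1 trmx); rewrite trmx_mul trmxK trmx0.
Qed.

Lemma line_in_normal_plane l p q (v N : V) : 
  direction l v ->
  q \in l -> N *m (q - p)^T = 0 -> N *m v^T = 0 ->
  l `<=` [set q | N *m (q - p)^T = 0].
Proof.
move=> hv ql Nq Nv x /mem_set /(hv q x ql).1[t ->] /=.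
by rewrite addrAC linearD linearZ /= mulmxDr Nq -scalemxAr Nv scaler0 addr0.
Qed.

Lemma rich_line l v p P e : v != 0 ->
  direction l v ->
  p \in l -> uniq P -> (e.*2 < count (fun q => q \in l) P)%N ->
  PolynomialMethod.rich P e p v.
Proof.
move=> v0 hv pl uP lts; split => //.
have /rV0Pn[i vi] := v0.
(* The parameter of a point is read off in a coordinate where [v] is nonzero. *)
pose t q := (q - p) 0 i / v 0 i.
have tE q : q \in l -> p + t q *: v = q.
  by move=> /(hv p q pl).1[s ->]; rewrite /t addrAC subrr add0r mxE mulfK.
exists [seq t q | q <- P & q \in l]; split.
- rewrite map_inj_in_uniq ?filter_uniq // => x y.
  by rewrite !mem_filter => /andP[xl _] /andP[yl _] txy; rewrite -(tE x) // txy tE.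
- by rewrite size_map size_filter.
by move=> _ /mapP[q + ->]; rewrite mem_filter => /andP[ql qP]; rewrite tE.
Qed.

Definition line_at p v : set V := [set q | exists t, q = p + t *: v].

Lemma line_atP p v : v != 0 -> is_line (line_at p v).
Proof.
move=> v0; exists p, <[v]>%VS; rewrite dim_vline v0; split=> //.
apply/seteqP; split => q /=.
  by move=> [t ->]; exists (t *: v) => //=; rewrite memvZ // memv_line.
by move=> [u /vlineP[t ->] <-]; exists t.
Qed.

Lemma mem_line_at p v t : p + t *: v \in line_at p v.
Proof. by rewrite inE; exists t. Qed.

Lemma line_at_eq l p v w : is_line l -> w != 0 -> v != 0 ->
  direction l w ->
  p \in l -> (w <= v)%MS -> l = line_at p v.
Proof.
move=> hl w0 v0 hw pl /sub_rVP[k wE].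
apply: (line_eq l _ p (p + w)) => //; first exact: line_atP.
- by apply: contraNneq w0 => e; rewrite -(addKr p w) -e addNr.
- by apply/(hw p _ pl); exists 1; rewrite scale1r.
- by rewrite -{1}[p]addr0 -(scale0r v) mem_line_at.
by rewrite wE mem_line_at.
Qed.

(** [D] lines in one plane with at least [D] points each have at least [D^2] incidences, while [k]
    points admit at most [k + D^2 / 2]; hence [k >= D^2 / 2]. The [D] lines come from [flat_plane],
    two at each of [e + 2] smooth points, whence the upper bound on [D]. *)
Lemma plane_with_many_points P L e D :
  uniq P -> uniq L -> {in L, forall l, is_line l} -> P != [::] ->
  (size P < 'C(3 + e, 3))%N -> (e.*2 < D <= e.*2 + 4)%N ->
  {in L, forall l, (D <= count (fun p => p \in l) P)%N} ->
  {in P, forall p, (3 <= count (fun l => p \in l) L)%N} ->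
  exists2 Pi, is_plane Pi & (D ^ 2 <= 2 * count (fun p => p \in Pi) P)%N.
Proof.
move=> uP uL lL P0 ltP /andP[eD De] lrich prich.
have rich_of l v p : l \in L -> v != 0 ->
  direction l v ->
  p \in l -> PolynomialMethod.rich P e p v.
  by move=> lL' v0 hv pl; apply: rich_line hv pl uP _ => //;
    rewrite (leq_trans eD) ?lrich.
have two p v : p \in P -> exists l1 l2,
    [/\ l1 \in L, l2 \in L, p \in l1, p \in l2 &
      [/\ l1 != l2, l1 != line_at p v & l2 != line_at p v]].
  move=> /prich/(count_others _ _ (line_at p v) _ uL)/(count_ge2 _ _ uL).
  by move=> [l1 [l2 [l1L l2L /andP[pl1 n1] /andP[pl2 n2] l12]]]; exists l1, l2.
have [|p v pP [v0 _]|p [v [N [G [pP [v0 [ts [uts lts tsP]]] N0 Nv [G0 sG flat]]]]]] :=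
  PolynomialMethod.flat_plane P0 ltP.
- move=> p pP; have [l [_ [l1 _ pl _ _]]] := two p 0 pP.
  have [v v0 hv] := line_param _ (lL l l1).
  by exists v; apply: rich_of l1 v0 hv pl.
- have [l1 [l2 [l1L l2L pl1 pl2 [l12 l1v l2v]]]] := two p v pP.
  have [w1 w10 h1] := line_param _ (lL l1 l1L).
  have [w2 w20 h2] := line_param _ (lL l2 l2L).
  exists w1, w2; split; [exact: rich_of h1 pl1|exact: rich_of h2 pl2| | |].
  + by apply: contra l1v => sub;
      rewrite (line_at_eq _ _ _ _ (lL _ l1L) w10 v0 h1 pl1 sub).
  + by apply: contra l2v => sub;
      rewrite (line_at_eq _ _ _ _ (lL _ l2L) w20 v0 h2 pl2 sub).
  apply: contra l12 => sub.
  rewrite (line_at_eq _ _ _ _ (lL _ l2L) w20 w10 h2 pl2 sub).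
  by rewrite -(line_at_eq _ _ _ _ (lL _ l1L) w10 w10 h1 pl1 (submx_refl _)).
pose Pi : set V := [set q | N *m (q - p)^T = 0].
exists Pi; first exact: normal_plane.
pose M := [seq l <- L | `[< l `<=` Pi >]].
have uM : uniq M by apply: filter_uniq.
have ML l : l \in M -> l \in L by rewrite mem_filter => /andP[].
have sM l : l \in M -> l `<=` Pi by rewrite mem_filter => /andP[/asboolP].
pose smooth := [seq t <- ts | ~~ root G t].
(* At least [2 e + 1] parameters, minus at most [e - 1] roots of [G]. *)
have s_smooth : (e.+2 <= size smooth)%N.
  have few : (count (root G) ts < e)%N.
    rewrite -size_filter; apply: leq_trans sG.
    apply: max_poly_roots; rewrite ?filter_uniq //.
    exact: filter_all.
  have : (e.*2 < count (root G) ts + size smooth)%N.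
    by rewrite [size smooth]size_filter count_predC.
  move: few; move: (count _ _) (size _) => a b; lia.
have smooth_inM t l : t \in smooth -> l \in L -> p + t *: v \in l -> l \in M.
  rewrite mem_filter => /andP[nrt tts] l_L ql; rewrite mem_filter l_L andbT.
  have [w w0 hw] := line_param _ (lL l l_L).
  have Nw := flat t w nrt (tsP t tts) (rich_of l w _ l_L w0 hw ql).
  apply/asboolP; apply: line_in_normal_plane hw ql _ Nw.
  by rewrite addrAC subrr add0r linearZ /= -scalemxAr Nv scaler0.
(* [line_at p v] need not belong to [L], but at least [e + 2] points of [P] on it
   are smooth, and each of them lies on two further lines of [L]. *)
have kM : (D <= size M)%N.
  apply: leq_trans De _; apply: (@leq_trans (e.+2 * 2)); first by lia.
  pose inc t l := (p + t *: v \in l) && (l != line_at p v).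
  apply: (@leq_trans (\sum_(t <- smooth) count (inc t) M)).
    rewrite -[size smooth]/_ in s_smooth.
    apply: (leq_trans (leq_mul s_smooth (leqnn 2))).
    rewrite -sum1_size big_distrl /= big_seq [X in (_ <= X)%N]big_seq.
    apply: leq_sum => t tsm; rewrite mul1n.
    have tts : t \in ts by move: tsm; rewrite mem_filter => /andP[].
    apply: leq_trans (count_others _ _ (line_at p v) _ uL (prich _ (tsP t tts))) _.
    rewrite count_filter; apply/eq_leq/eq_in_count => l l_L /=.
    rewrite /inc; case: (boolP (_ \in l)) => //= ql.
    by have := smooth_inM t l tsm l_L ql; rewrite mem_filter => /andP[->];
      rewrite andbT.
  (* A line of [M] other than [line_at p v] meets it at most once, so it is counted for at most one
     parameter. *)
  rewrite double_count -[size M]sum1_size big_seq [X in (_ <= X)%N]big_seq.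
  apply: leq_sum => l lM; apply: count_le1; first exact: filter_uniq.
  move=> t1 t2 _ _ /andP[t1l nl] /andP[t2l _]; apply/eqP/negPn/negP => t12.
  move/eqP: nl; apply; apply: (line_eq _ _ _ _ _ _ _ t1l t2l); rewrite ?mem_line_at //.
  - exact/lL/ML.
  - exact: line_atP.
  apply: contra t12 => /eqP/addrI/eqP; rewrite -subr_eq0 -scalerBl scaler_eq0.
  by rewrite (negPf v0) orbF subr_eq0.
(* Exactly [D] lines are kept: the quadratic term of the pair count would spoil the estimate if [M]
   were much larger. *)
pose M1 := take D M.
have sM1 : size M1 = D by rewrite size_takel.
pose Q := [seq q <- P | q \in Pi].
have up : (2 * \sum_(q <- Q) count (fun l => q \in l) M1 <= 2 * size Q + D ^ 2)%N.
  rewrite -sM1; apply: sum_count_pairs; first exact: take_uniq.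
  move=> l l' /mem_take lM /mem_take l'M ll'; apply: count_le1; first exact: filter_uniq.
  exact/lines_meet_once/ll'/lL/ML/l'M/lL/ML.
have low : (D * D <= \sum_(q <- Q) count (fun l => q \in l) M1)%N.
  rewrite double_count -{1}sM1 -sum1_size big_distrl /= big_seq.
  rewrite [X in (_ <= X)%N]big_seq.
  apply: leq_sum => l /mem_take lM; rewrite mul1n.
  apply: (leq_trans (lrich l (ML l lM))).
  rewrite count_filter; apply/eq_leq/eq_in_count => q qP /=.
  case: (boolP (q \in l)) => //= /set_mem ql.
  by apply/esym/mem_set/(sM l lM).
by move: up low; rewrite size_filter -mulnn; lia.
Qed.

(** * Cube root estimates and the induction on points and lines *)

Definition cbrt (n : nat) : R := n%:R `^ (1 / 3).

Lemma cbrt_ge0 n : 0 <= cbrt n.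
Proof. exact: powR_ge0. Qed.

Lemma cbrt3 n : cbrt n ^+ 3 = n%:R.
Proof.
rewrite -powR_mulrn ?cbrt_ge0 // -powRrM.
by rewrite div1r mulVf ?pnatr_eq0 // powRr1.
Qed.

Lemma cbrt_le n n' : (n <= n')%N -> cbrt n <= cbrt n'.
Proof. by move=> nn'; rewrite ge0_ler_powR ?nnegrE // ?divr_ge0 // ler_nat. Qed.

(** With [y^3 - x^3 = k] and [x <= y], factoring gives [k <= 3 y^2 (y - x)]; and
    [6.69 / 3 = 2.23]. *)
Lemma cbrt_gap n k : (0 < n + k)%N -> 669 / 100 * cbrt (n + k) ^+ 2 <= k%:R ->
  cbrt n + 223 / 100 <= cbrt (n + k).
Proof.
move=> nk0; have := cbrt_ge0 n; have := cbrt_ge0 (n + k).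
have := cbrt_le _ _ (leq_addr k n).
have := cbrt3 n; have := cbrt3 (n + k).
have : (n + k)%:R != 0 :> R by rewrite pnatr_eq0 -lt0n.
rewrite natrD; set y := cbrt (n + k); set x := cbrt n.
move=> nz y3 x3 xy y0 x0 gap.
have yp : 0 < y ^+ 2.
  by rewrite exprn_gt0 // lt0r y0 andbT;
    apply: contraNneq nz => y00; rewrite -y3 y00 expr0n.
have f : (y - x) * (y ^+ 2 + y * x + x ^+ 2) = k%:R.
  have -> : k%:R = y ^+ 3 - x ^+ 3 by rewrite y3 x3; ring.
  by ring.
have le3 : (y - x) * (y ^+ 2 + y * x + x ^+ 2) <= (y - x) * (3 * y ^+ 2).
  by apply: ler_wpM2l; nra.
rewrite -subr_ge0 -(pmulr_rge0 _ yp).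
lra.
Qed.

(** Six times the binomial coefficient is [(e + 1)(e + 2)(e + 3)], at least [(e + 1)^3]. *)
Lemma bin3_gt e n : (6 * n < e.+1 ^ 3)%N -> (n < 'C(3 + e, 3))%N.
Proof.
move=> h; rewrite -(ltn_pmul2r (fact_gt0 3)) bin_ffact.
rewrite !ffactnS ffactn0 !addSn add0n /= muln1.
have -> : (3`! = 6)%N by [].
by nia.
Qed.

(** A line not contained in [Pi] meets it at most once, so such lines contribute at most [size L];
    the lines inside [Pi] are handled by counting pairs. *)
Lemma plane_split P L Pi :
  uniq L -> {in L, forall l, is_line l} -> is_plane Pi -> uniq P ->
  (2 * \sum_(p <- P | p \in Pi) count (fun l => p \in l) L <=
   2 * size L + 2 * count (fun p => p \in Pi) P +
   count (fun l => `[< l `<=` Pi >]) L ^ 2)%N.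
Proof.
move=> uL lL hPi uP.
pose inPi l := `[< l `<=` Pi >].
pose Q := [seq q <- P | q \in Pi].
have uQ : uniq Q by apply: filter_uniq.
rewrite -big_filter -/Q -[count (fun p => p \in Pi) P]size_filter -/Q.
have in_pairs : (2 * \sum_(p <- Q) count (fun l => p \in l) (seq.filter inPi L) <=
    2 * size Q + count inPi L ^ 2)%N.
  rewrite -[count inPi L]size_filter; apply: sum_count_pairs; first exact: filter_uniq.
  move=> l l'; rewrite !mem_filter => /andP[_ /lL hl] /andP[_ /lL hl'] ll'.
  by apply: count_le1 => //; exact: lines_meet_once.
have out : (\sum_(p <- Q)
    count (fun l => p \in l) (seq.filter (predC inPi) L) <= size L)%N.
  rewrite double_count.
  apply: (@leq_trans (size (seq.filter (predC inPi) L)));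
    last by rewrite size_filter count_size.
  rewrite -sum1_size big_seq [X in (_ <= X)%N]big_seq; apply: leq_sum => l.
  rewrite mem_filter => /andP[/asboolPn nPi /lL hl]; apply: count_le1 => // p q.
  rewrite !mem_filter => /andP[pPi _] /andP[qPi _] pl ql.
  by apply/eqP/negPn/negP => pq; exact/nPi/(line_sub_flat _ _ _ _ _ hl hPi pq).
have -> : (\sum_(p <- Q) count (fun l => p \in l) L =
    \sum_(p <- Q) count (fun l => p \in l) (seq.filter inPi L) +
    \sum_(p <- Q) count (fun l => p \in l) (seq.filter (predC inPi) L))%N.
  rewrite -big_split /=; apply: eq_bigr => p _.
  by rewrite -count_cat; apply/esym/permP; rewrite perm_filterC.
by move: in_pairs out; rewrite -/inPi; lia.
Qed.

Lemma incidence_bound P L (K : R) :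
  uniq P -> uniq L -> {in L, forall l, is_line l} ->
  (forall Pi, is_plane Pi -> (count (fun l => `[< l `<=` Pi >]) L)%:R <= K) ->
  (\sum_(p <- P) count (fun l => p \in l) L)%:R <=
    366 / 100 * (size L)%:R * cbrt (size P) + 91 / 100 * K ^+ 2 * cbrt (size P)
    + 676 / 100 * (size P)%:R.
Proof.
have nonneg (a b : nat) (y : R) : 0 <= y ->
    0 <= 366 / 100 * a%:R * y + 91 / 100 * K ^+ 2 * y + 676 / 100 * b%:R.
  move=> y0; have := mulr_ge0 (ler0n R a) y0; have := mulr_ge0 (sqr_ge0 K) y0.
  by have := ler0n R b; lra.
move: {2}(size P + size L)%N (leqnn (size P + size L)) => N.
elim: N P L => [|N IH] P L sN uP uL lL hK.
  move: sN; rewrite leqn0 addn_eq0 => /andP[/nilP -> _]; rewrite big_nil [leLHS]mulr0n.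
  by apply: nonneg; exact: cbrt_ge0.
have y0 := cbrt_ge0 (size P); have K0 := sqr_ge0 K.
have [->|P0] := eqVneq P [::]; first by
  rewrite big_nil [leLHS]mulr0n; apply: nonneg; exact: cbrt_ge0.
have sP0 : (0 < size P)%N by case: (P) P0.
have [/hasP[l l_L poor]|lrich] :=
  boolP (has (fun l => (count (fun p => p \in l) P)%:R <=
                       366 / 100 * cbrt (size P) :> R) L).
  (* Deleting the line loses at most [3.66 y] incidences, exactly the drop of the first term of the
     bound. *)
  rewrite double_count (big_rem l l_L) -double_count natrD.
  have sL : size L = (size (rem l L)).+1.
    by rewrite size_rem // prednK //; case: (L) l_L.
  have /(_ _ uP (rem_uniq _ uL)) := IH P (rem l L).
  have sub : {subset rem l L <= L} := mem_subseq (rem_subseq l L).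
  have h1 : (size P + size (rem l L) <= N)%N by rewrite -ltnS -addnS -sL.
  have h2 : {in rem l L, forall l', is_line l'} by move=> l' /sub; exact: lL.
  have h3 Pi : is_plane Pi -> (count (fun l => `[< l `<=` Pi >]) (rem l L))%:R <= K.
    by move/hK; apply: le_trans; rewrite ler_nat leq_count_subseq ?rem_subseq.
  move=> /(_ h1 h2 h3); rewrite sL -[(size _).+1]addn1 natrD; lra.
have [/hasP[p pP poor]|prich] :=
  boolP (has (fun p => (count (fun l => p \in l) L <= 2)%N) P).
  (* Deleting the point loses at most 2 incidences, and the last term drops by 6.76. *)
  rewrite (big_rem p pP) natrD.
  have sP : size P = (size (rem p P)).+1.
    by rewrite size_rem // prednK //; case: (P) pP.
  have h1 : (size (rem p P) + size L <= N)%N by rewrite -ltnS -addSn -sP.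
  have := IH _ _ h1 (rem_uniq _ uP) uL lL hK.
  have yy : cbrt (size (rem p P)) <= cbrt (size P) :> R.
    by apply: cbrt_le; rewrite sP.
  have c2 : (count (fun l => p \in l) L)%:R <= 2 :> R by rewrite (ler_nat _ _ 2).
  have a1 : (size L)%:R * cbrt (size (rem p P)) <= (size L)%:R * cbrt (size P) :> R.
    by rewrite ler_wpM2l.
  have a2 : K ^+ 2 * cbrt (size (rem p P)) <= K ^+ 2 * cbrt (size P).
    by rewrite ler_wpM2l.
  have nP : (size P)%:R = (size (rem p P))%:R + 1 :> R.
    by rewrite {1}sP -addn1 natrD.
  lra.
set y := cbrt (size P) in y0 lrich *.
have y3 : y ^+ 3 = (size P)%:R := cbrt3 _.
(* Since [1.83^3 > 6], one gets [(e + 1)^3 > 6 y^3], as [bin3_gt] requires. [D] is the least integer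
   above [3.66 y], so every remaining line has at least [D] points. *)
pose e := Num.truncn (183 / 100 * y); pose D := (Num.truncn (366 / 100 * y)).+1.
have /truncn_itv/andP[] : 0 <= 183 / 100 * y by lra.
rewrite -/e => e_le e_gt.
have /truncn_itv/andP[] : 0 <= 366 / 100 * y by lra.
rewrite -/D => D_le D_gt.
have sPe : (size P < 'C(3 + e, 3))%N.
  apply: bin3_gt; rewrite -(ltr_nat R) natrM natrX -y3.
  have : (183 / 100 * y) ^+ 3 < e.+1%:R ^+ 3 by rewrite ltrXn2r //; lra.
  apply: le_lt_trans; rewrite exprMn ler_wpM2r ?exprn_ge0 //; lra.
have eD : (e.*2 < D <= e.*2 + 4)%N.
  apply/andP; split; first by rewrite -(ltr_nat R) -mul2n natrM; lra.
  have : (Num.truncn (366 / 100 * y) < e.*2 + 2)%N.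
    by rewrite -(ltr_nat R) natrD -mul2n natrM; lra.
  by move/leq_trans; apply; rewrite leq_add2l.
have lrich' : {in L, forall l, (D <= count (fun p => p \in l) P)%N}.
  move=> l l_L; rewrite /D -(ltr_nat R); apply: le_lt_trans D_le _.
  by have /hasPn/(_ l l_L) := lrich; rewrite -ltNge.
have prich' : {in P, forall p, (3 <= count (fun l => p \in l) L)%N}.
  by move=> p pP; have /hasPn/(_ p pP) := prich; rewrite -ltnNge.
have [Pi hPi DPi] := plane_with_many_points _ _ _ _ uP uL lL P0 sPe eD lrich' prich'.
have := plane_split _ _ _ uL lL hPi uP; have := hK Pi hPi.
move: DPi; set q := count _ P; set k := count _ L => DPi kK split_le.
pose P' := [seq p <- P | p \notin Pi].
have sP' : (size P' + q = size P)%N.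
  by rewrite /P' size_filter addnC -(count_predC (fun p => p \in Pi) P).
(* From [D > 3.66 y] and [3.66^2 / 2 > 6.69]. *)
have q_ge : 669 / 100 * y ^+ 2 <= q%:R.
  have : D%:R ^+ 2 <= 2 * q%:R :> R by rewrite -natrX -natrM ler_nat.
  by nra.
have q0 : (0 < q)%N.
  by rewrite lt0n; apply: contraTneq DPi => ->; rewrite muln0 leqNgt expn_gt0.
have h1 : (size P' + size L <= N)%N.
  by rewrite -ltnS; apply: leq_trans sN; rewrite -sP' addnAC -addn1 leq_add2l.
have := IH P' L h1 (filter_uniq _ uP) uL lL hK.
have gap : cbrt (size P') + 223 / 100 <= y.
  by rewrite /y -sP'; apply: cbrt_gap; rewrite ?sP' // -/y.
have nP : (size P)%:R = (size P')%:R + q%:R :> R by rewrite -natrD sP'.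
have kK2 : k%:R ^+ 2 <= K ^+ 2 by rewrite lerXn2r ?nnegrE // (le_trans _ kK).
have gapL := ler_wpM2l (ler0n R (size L)) gap.
have m0 := ler0n R (size L); have q0R := ler0n R q.
have gapK := ler_wpM2l K0 gap.
(* The loss is at most [size L + q + K^2 / 2]. The bound drops by at least [3.66 * 2.23] times
   [size L], plus [0.91 * 2.23] times [K^2], plus [6.76 q]. *)
rewrite big_filter nP [in X in _ -> X](bigID (fun p => p \in Pi)) /= natrD.
move: split_le; rewrite -(ler_nat R) natrM 2!natrD natrX 2!natrM.
move: {y3 e_le e_gt D_le D_gt q_ge} gapL gapK kK2 m0 q0R K0; lra.
Qed.

End Geometry.

Lemma card_fset_count (T : choiceType) (A : {fset T}) (a : pred T) :
  #|` [fset x in A | a x]|%fset = count a A.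
Proof.
by rewrite card_fset_sum1 -big_fset_condE sum1_count.
Qed.

Theorem theorem2 (R : realType) (m n : nat)
    (L : {fset set 'rV[R[i]]_3}) (P : {fset 'rV[R[i]]_3}) (c : R)
    (hL : forall l : set 'rV[R[i]]_3, l \in L -> is_line l)
    (hm : #|` L|%fset = m) (hn : #|` P|%fset = n)
    (hc : forall Pi : set 'rV[R[i]]_3, is_plane Pi ->
       (lines_in L Pi)%:R <= c * Num.sqrt (m%:R : R)) :
  (incidences L P)%:R <=
    (366 / 100 + 91 / 100 * c ^+ 2) * m%:R * n%:R `^ (1 / 3)
      + 676 / 100 * n%:R.
Proof.
(* With [K = c sqrt m], the term in [K^2] becomes the term in [c^2 m] of the bound. *)
have K2 : (c * Num.sqrt (m%:R : R)) ^+ 2 = c ^+ 2 * m%:R.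
  by rewrite exprMn sqr_sqrtr.
have := @incidence_bound R P L (c * Num.sqrt m%:R) (fset_uniq P) (fset_uniq L) hL.
rewrite K2 -[size P]/(#|` P|%fset) -[size L]/(#|` L|%fset) hm hn /cbrt.
have -> : incidences L P = (\sum_(p <- P) count (fun l => p \in l) L)%N.
  by apply: eq_bigr => p _; rewrite /lines_through card_fset_count.
move=> bound; rewrite 2!mulrDl -[_ * c ^+ 2 * _]mulrA; apply: bound => Pi /hc.
by rewrite /lines_in card_fset_count.
Qed.
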